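(* Let $n\ge 2$ and let $k\ge 0$ be an integer. Given any $C^{k+2}$ function $\varphi:(0,\infty)\to\mathbb{R}$ satisfying $$\lim_{s\to\infty}\varphi(s)=\infty\qquad\text{and}\qquad \lim_{s\to\infty}\varphi'(s)=\cdots=\lim_{s\to\infty}\varphi^{(k+2)}(s)=0,$$ there is a compactly supported function $u:\mathbb{R}^n\to\mathbb{R}$, depending on $\varphi$, such that $u$ is $(k+2)$-times differentiable everywhere in $\mathbb{R}^n$, $\Delta u$ is $C^k$ on $\mathbb{R}^n$, $D^{k+2}u$ is bounded on $\mathbb{R}^n$, but $u\notin C^{k+2}(\mathbb{R}^n)$.
   Context: $D^{k+2}u$ denotes the collection of all partial derivatives of $u$ of order $k+2$; it is bounded if each of them is a bounded function on $\mathbb{R}^n$. *)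

(* Defs.v *)
From mathcomp Require Import all_boot all_order all_algebra.
From mathcomp Require Import all_classical all_reals all_analysis.

Set Implicit Arguments.
Unset Strict Implicit.
Unset Printing Implicit Defensive.

Import Order.TTheory GRing.Theory Num.Theory.
Import numFieldNormedType.Exports.

Local Open Scope classical_set_scope.
Local Open Scope ring_scope.

(* [phi : R -> R] stands for a function on ]0, +oo[: its values outside that
   open interval are unconstrained and do not affect its derivatives there. *)
Definition Ck_pos (R : realType) (m : nat) (phi : R -> R) : Prop :=
  (forall (j : nat) (s : R), (j < m)%N -> 0 < s -> derivable (derive1n j phi) s 1) /\
  (forall s : R, 0 < s -> {for s, continuous (derive1n m phi)}).

Definition pderiv (R : realType) (n : nat) (i : 'I_n)
    (f : 'rV[R]_n -> R) : 'rV[R]_n -> R :=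
  fun x => 'D_(delta_mx 0 i) f x.

(* [pderivs [:: i1; ...; im] f] is d_i1 (... (d_im f)). *)
Definition pderivs (R : realType) (n : nat) (s : seq 'I_n)
    (f : 'rV[R]_n -> R) : 'rV[R]_n -> R :=
  foldr (@pderiv R n) f s.

(* Differentiability is in the sense of Frechet, which is stronger than the
   existence of all partial derivatives up to order [m]. A function is [m]
   times differentiable when it is differentiable and its differential, that
   is, each of its partial derivatives, is [m - 1] times differentiable. *)
Definition times_differentiable (R : realType) (n m : nat)
    (f : 'rV[R]_n -> R) : Prop :=
  forall s : seq 'I_n, (size s < m)%N ->
  forall x : 'rV[R]_n, differentiable (pderivs s f) x.

Definition Ck (R : realType) (n m : nat) (f : 'rV[R]_n -> R) : Prop :=
  (forall (s : seq 'I_n) (i : 'I_n) (x : 'rV[R]_n), (size s < m)%N ->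
     derivable (pderivs s f) x (delta_mx 0 i)) /\
  (forall s : seq 'I_n, (size s <= m)%N -> continuous (pderivs s f)).

Definition laplacian (R : realType) (n : nat) (f : 'rV[R]_n -> R) :
    'rV[R]_n -> R :=
  fun x => \sum_(i < n) pderiv i (pderiv i f) x.

Definition compactly_supported (R : realType) (n : nat)
    (f : 'rV[R]_n -> R) : Prop :=
  compact (closure [set x | f x != 0]).

(* Main.v *)
Require Import Defs.
From mathcomp Require Import all_boot all_order all_algebra.
From mathcomp Require Import all_classical all_reals all_analysis.
From mathcomp Require Import ring lra zify.

Import Order.TTheory GRing.Theory Num.Theory.
Import numFieldNormedType.Exports.

Local Open Scope classical_set_scope.
Local Open Scope ring_scope.

Set Implicit Arguments.
Unset Strict Implicit.
Unset Printing Implicit Defensive.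

(** The function [u] is a sum of bumps with disjoint supports accumulating at the
    origin. At their centres a derivative of order [k + 2] takes values tending
    to [(k + 2)!], while their supports are so small that the derivatives of lower
    order are negligible with respect to the distance to the origin.

    One bump. Let [P] be the real part of [(x_0 + i x_1) ^ (k + 2)], a harmonic
    polynomial, and let [L] be the logarithm of [|x|^2 + delta], normalised by
    a small factor [lambda] so that [L] equals [1] at the origin. The gradient
    of [L] is only [O(lambda / |x|)]. In a derivative of order [k + 2] of [P L],
    every term that differentiates [L] is therefore [O(lambda)], and the others
    are bounded; at the origin the value is [(k + 2)! + O(lambda)]. The
    Laplacian of [P L] is [2 grad P . grad L + P Delta L], because [P] is
    harmonic, hence every term contains a derivative of [L] and the Laplacian is
    [O(lambda)] together with its derivatives up to order [k]. A cutoff of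
    finite smoothness, vanishing outside the unit ball, preserves all this. Such
    estimates, uniform in [lambda], are organised by the classes [symbol] below,
    which are closed under sums, products and derivatives
    ([symbolD], [symbolM], [symbol_pderivs]); the outcome is
    [pderivs_profile_le], [pderivs_laplacian_profile_le] and [pderivs_profile0].

    Gluing. With [lambda = 2^-j], the [j]-th bump is centred at distance [2^-j]
    from the origin and rescaled to the radius [r = 4^-j / 8], with the factor
    [r ^ (k + 2)] in front. The derivatives of order [k + 2] keep their size;
    those of order at most [k + 1] are [O(r)], that is, [O(|x|^2)] on the support.
    So all the derivatives of order at most [k + 1] of the sum are [O(|x|^2)],
    hence differentiable at the origin with zero differential
    ([pderivs_glued_quadratic], [glued_smooth]). The derivatives of the
    Laplacian are [O(2^-j)], that is, [O(|x|)], on the [j]-th support, so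
    they are continuous ([laplacian_glued_Ck]). Finally the derivative of order
    [k + 2] along the first axis tends to [(k + 2)!] along the centres, but it
    is [0] at their limit ([glued_not_Ck]). *)

(** * First-order calculus of functions on row vectors *)

(** The remainder is itself [O(|y - x|^2)], so the zero map is the differential. *)
Lemma diff_quadratic (R : realType) (V W : normedModType R) (f : V -> W) C x :
  (\forall y \near x, `|f y| <= C * `|y - x| ^+ 2) ->
  differentiable f x /\ 'd f x = \0 :> (V -> W).
Proof.
move=> fC; have f0 : f x = 0.
  have := nbhs_singleton fC.
  by rewrite subrr normr0 expr0n/= mulr0 normr_le0 => /eqP.
have fo : f \o shift x = cst (f x) + \0 +o_ 0 id.
  apply/eqaddoP => _/posnumP[e].
  have fC0 : \forall y \near (0 : V), `|f (y + x)| <= C * `|y| ^+ 2.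
    rewrite (near_shift x)/=; near=> y; rewrite sub0r /= subrK; near: y.
    exact: fC.
  near=> y.
  rewrite [X in `|X|](_ : _ = f (y + x)) /=; last first.
    by rewrite !fctE/= f0 addr0 subr0.
  have yC : `|y| <= e%:num / (`|C| + 1).
    near: y; apply/nbhs0_le; exact: divr_gt0.
  apply: (@le_trans _ _ (C * `|y| ^+ 2)); first by near: y.
  rewrite expr2 mulrA ler_wpM2r//.
  apply: (@le_trans _ _ (`|C| * `|y|)); first by rewrite ler_wpM2r// ler_norm.
  apply: (@le_trans _ _ ((`|C| + 1) * `|y|)); first by rewrite ler_wpM2r// lerDl.
  by rewrite mulrC -ler_pdivlMr.
have d0 : 'd f x = \0 :> (V -> W).
  by apply/diff_unique => //; exact: cst_continuous.
split => //.
by apply/diff_locallyP; rewrite d0; split => //; exact: cst_continuous.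
Unshelve. all: by end_near. Qed.

Section Calculus.
Variables (R : realType) (n : nat).
Implicit Types (f g : 'rV[R]_n -> R) (i : 'I_n) (x : 'rV[R]_n).

Lemma pderivE f i x : differentiable f x ->
  pderiv i f x = 'd f x (delta_mx 0 i).
Proof. exact: deriveE. Qed.

Lemma mulfE f g x : (f * g) x = f x * g x. Proof. by []. Qed.

Lemma addfE f g x : (f + g) x = f x + g x. Proof. by []. Qed.

Lemma pderiv_cst c i : pderiv i (cst c : 'rV[R]_n -> R) = cst 0.
Proof. by apply/funext => x; rewrite /pderiv derive_cst. Qed.

Lemma pderivD f g i : (forall x, differentiable f x) ->
  (forall x, differentiable g x) ->
  pderiv i (f + g) = pderiv i f + pderiv i g.
Proof.
move=> df dg; apply/funext => x.
by rewrite /pderiv deriveD//; exact: diff_derivable.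
Qed.

Lemma pderivM f g i : (forall x, differentiable f x) ->
  (forall x, differentiable g x) ->
  pderiv i (f * g) = pderiv i f * g + f * pderiv i g.
Proof.
move=> df dg; apply/funext => x.
rewrite /pderiv deriveM/=; [|exact: diff_derivable..].
by rewrite [RHS]addrC; congr (_ + _); exact: mulrC.
Qed.

Lemma pderivZ c f i : (forall x, differentiable f x) ->
  pderiv i (cst c * f) = cst c * pderiv i f.
Proof.
move=> df; rewrite pderivM// pderiv_cst; apply/funext => x.
by rewrite addfE !mulfE mul0r add0r.
Qed.

Lemma pderiv2M f g i : (forall x, differentiable f x) ->
  (forall x, differentiable g x) ->
  (forall x, differentiable (pderiv i f) x) ->
  (forall x, differentiable (pderiv i g) x) ->
  pderiv i (pderiv i (f * g)) = pderiv i (pderiv i f) * g +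
    (cst 2 * (pderiv i f * pderiv i g) + f * pderiv i (pderiv i g)).
Proof.
move=> df dg df' dg'; rewrite (pderivM i df dg) pderivD; last 2 first.
- by move=> x; exact: differentiableM.
- by move=> x; exact: differentiableM.
rewrite (pderivM i df' dg) (pderivM i df dg') -!addrA; congr (_ + _).
rewrite addrA; congr (_ + _); apply/funext => x.
by rewrite addfE mulfE [in RHS]mulfE mulr_natl mulr2n.
Qed.

Lemma pderiv_sum m (F : 'I_m -> 'rV[R]_n -> R) i :
  (forall l x, differentiable (F l) x) ->
  pderiv i (\sum_l F l) = \sum_l pderiv i (F l).
Proof.
move=> dF; apply/funext => x; rewrite /pderiv derive_sum ?fct_sumE// => l.
exact: diff_derivable.
Qed.

Lemma pderiv_comp (h : R -> R) f i x : differentiable f x ->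
  derivable h (f x) 1 ->
  pderiv i (h \o f) x = derive1 h (f x) * pderiv i f x.
Proof.
move=> df dh; have dh' : differentiable h (f x) by exact/derivable1_diffP.
rewrite !pderivE//; last exact: differentiable_comp.
by rewrite diff_comp//= deriv1E// mulrC.
Qed.

Lemma differentiable_crd i x : differentiable (fun y : 'rV[R]_n => y 0 i) x.
Proof. exact: differentiable_coord. Qed.

Lemma pderiv_crd i l : pderiv i (fun y : 'rV[R]_n => y 0 l) = cst (i == l)%:R.
Proof.
apply/funext => x; rewrite /pderiv /derive /=.
rewrite (_ : (fun h => _) = (fun h : R => h^-1 * h * (i == l)%:R)); last first.
  by apply/funext => h; rewrite !mxE eqxx/= addrK -mulrA eq_sym.
apply: cvg_lim => //; apply: cvg_near_cst.
near=> h; rewrite mulVf ?mul1r//; near: h; exact: nbhs_dnbhs_neq.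
Unshelve. all: by end_near. Qed.

(** A partial derivative depends on a neighbourhood only, and functions that agree
    near [x] also agree near every point close to [x]. *)
Lemma near_pderivs f g x s : (\near x, f x = g x) ->
  \forall y \near x, pderivs s f y = pderivs s g y.
Proof.
elim: s => [//|i s IH] /IH /near_join; apply: filterS => y fg.
exact: near_eq_derive.
Qed.

Lemma pderiv_quadratic f C x :
  (\forall y \near x, `|f y| <= C * `|y - x| ^+ 2) ->
  differentiable f x /\ forall i, pderiv i f x = 0.
Proof.
move=> /diff_quadratic[df d0]; split => // i.
by rewrite pderivE// d0.
Qed.

(** The difference of the two functions vanishes near [x], so that
    [pderiv_quadratic] applies to it. *)
Lemma near_differentiable f g x : (\near x, f x = g x) ->
  differentiable f x -> differentiable g x.
Proof.
move=> fg df; have -> : g = (g - f) + f by rewrite subrK.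
apply: differentiableD => //.
have [] // := @pderiv_quadratic (g - f) 0 x.
apply: filterS fg => y fgy.
by rewrite mul0r /GRing.add/= /GRing.opp/= fgy subrr normr0.
Qed.

End Calculus.

(** * Symbol classes *)

(** The small factor [lambda] of the [j]-th bump; it is also the distance from
    the centre of that bump to the origin. *)
Definition dyad (R : realType) (j : nat) : R := 2 ^- j.

(** Chosen so that [- dyad R j * ln (delta R j) = 1]. *)
Definition delta (R : realType) (j : nat) : R := expR (- (dyad R j)^-1).

Definition sqnorm (R : realType) (n : nat) (x : 'rV[R]_n) : R :=
  \sum_i x 0 i ^+ 2.

Definition rsq (R : realType) (n : nat) (j : nat) (x : 'rV[R]_n) : R :=
  sqnorm x + delta R j.

(** A smooth substitute for the Euclidean norm of [x], which stays positive at
    the origin. *)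
Definition rad (R : realType) (n : nat) (j : nat) (x : 'rV[R]_n) : R :=
  Num.sqrt (rsq j x).

(** The constant is uniform in [j]: everything that depends on the bump is in
    the weights. The unit ball suffices because the profiles vanish outside. *)
Definition dominated (R : realType) (n e : nat) (d : int)
    (F : nat -> 'rV[R]_n -> R) : Prop :=
  exists C, forall j x, sqnorm x <= 1 ->
    `|F j x| <= C * (dyad R j ^+ e * rad j x ^ d).

(** As for symbols of order [d], each derivative costs one power of [rad]. The
    recursion takes the derivative that is applied first, so that closure
    properties follow from the rules for one partial derivative. *)
Fixpoint symbol (R : realType) (n m e : nat) (d : int)
    (F : nat -> 'rV[R]_n -> R) : Prop :=
  [/\ forall j x, differentiable (F j) x,
      dominated e d F
    & if m is m'.+1 then
        forall i, symbol m' e (d - 1) (fun j => pderiv i (F j))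
      else True].

Section Symbols.
Variables (R : realType) (n : nat).
Implicit Types (F G : nat -> 'rV[R]_n -> R) (i : 'I_n) (x : 'rV[R]_n).

Lemma dyad_gt0 j : 0 < dyad R j.
Proof. by rewrite /dyad invr_gt0 exprn_gt0. Qed.

Lemma dyad_le1 j : dyad R j <= 1.
Proof. by rewrite /dyad invf_le1 ?exprn_gt0// exprn_ege1// ler1n. Qed.

Lemma delta_gt0 j : 0 < delta R j. Proof. exact: expR_gt0. Qed.

Lemma delta_le1 j : delta R j <= 1.
Proof. by rewrite /delta -expR0 ler_expR oppr_le0 invr_ge0 ltW// dyad_gt0. Qed.

Lemma sqnorm_ge0 x : 0 <= sqnorm x.
Proof. by apply: sumr_ge0 => i _; exact: sqr_ge0. Qed.

Lemma rsq_gt0 j x : 0 < rsq j x.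
Proof. by rewrite /rsq ltr_wpDl ?delta_gt0 ?sqnorm_ge0. Qed.

Lemma rad_gt0 j x : 0 < rad j x.
Proof. by rewrite sqrtr_gt0 rsq_gt0. Qed.

Lemma sqr_rad j x : rad j x ^+ 2 = rsq j x.
Proof. by rewrite sqr_sqrtr// ltW// rsq_gt0. Qed.

Lemma rad_le2 j x : sqnorm x <= 1 -> rad j x <= 2.
Proof.
move=> x1.
rewrite -(@ler_pXn2r _ 2)// ?nnegrE ?(ltW (rad_gt0 _ _))// sqr_rad.
by have := delta_le1 j; rewrite /rsq; lra.
Qed.

Lemma crd_le_rad j i x : `|x 0 i| <= rad j x.
Proof.
rewrite -(@ler_pXn2r _ 2)// ?nnegrE ?(ltW (rad_gt0 _ _))// sqr_rad.
rewrite real_normK ?num_real// /rsq /sqnorm (bigD1 i)//= -addrA lerDl.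
by rewrite addr_ge0 ?(ltW (delta_gt0 _))// sumr_ge0// => l _; exact: sqr_ge0.
Qed.

(** On the unit ball [rad] is at most [2] and [dyad] at most [1]; dropping powers
    of them costs a constant. *)
Lemma dominated_weaken e e' d d' F : (e' <= e)%N -> (d' <= d)%R ->
  dominated e d F -> dominated e' d' F.
Proof.
move=> ee' dd' [C bF]; exists (`|C| * 2 ^+ `|d - d'|%N) => j x x1.
have r0 := rad_gt0 j x; have l0 := dyad_gt0 j.
apply: (le_trans (bF j x x1)).
apply: (@le_trans _ _ (`|C| * (dyad R j ^+ e * rad j x ^ d))).
  by rewrite ler_wpM2r ?ler_norm// mulr_ge0 ?exprz_ge0 ?exprn_ge0// ltW.
rewrite -mulrA ler_wpM2l//.
rewrite -{1}(subrK d' d) expfzDr ?gt_eqF// mulrCA.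
have -> : rad j x ^ (d - d') = rad j x ^+ `|d - d'|%N.
  by rewrite exprnP gez0_abs// subr_ge0.
have r1 := ltW r0; have l1 := ltW l0.
apply: ler_pM.
- exact: exprn_ge0.
- by rewrite mulr_ge0 ?exprz_ge0 ?exprn_ge0.
- by rewrite lerXn2r ?nnegrE// rad_le2.
- by rewrite ler_wpM2r ?exprz_ge0// ler_wiXn2l// dyad_le1.
Qed.

Lemma dominatedD e d F G : dominated e d F -> dominated e d G ->
  dominated e d (fun j => F j + G j).
Proof.
move=> [C bF] [D bG]; exists (C + D) => j x x1.
rewrite mulrDl; apply: le_trans (ler_normD _ _) _.
by rewrite lerD ?bF ?bG.
Qed.

Lemma dominatedM e1 e2 d1 d2 F G : dominated e1 d1 F -> dominated e2 d2 G ->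
  dominated (e1 + e2) (d1 + d2) (fun j => F j * G j).
Proof.
move=> [C bF] [D bG]; exists (C * D) => j x x1.
rewrite [_ x]/(F j x * G j x) normrM exprD expfzDr ?gt_eqF ?rad_gt0//.
by rewrite [_ ^+ e1 * _ * _]mulrACA (mulrACA C D) ler_pM ?bF ?bG.
Qed.

Lemma symbol_le m m' e d F : (m' <= m)%N -> symbol m e d F -> symbol m' e d F.
Proof.
elim: m m' e d F => [|m IH] [|m'] e d F //= mm' [dF bF sF]; split => // i.
by apply: IH mm' _; exact: sF.
Qed.

Lemma symbol_weaken m e e' d d' F : (e' <= e)%N -> (d' <= d)%R ->
  symbol m e d F -> symbol m e' d' F.
Proof.
move=> ee'; elim: m d d' F => [|m IH] d d' F dd' [dF bF sF]; split => //;
  try exact: dominated_weaken bF.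
by move=> i; apply: IH (sF i); rewrite lerD2r.
Qed.

Lemma symbolD m e d F G : symbol m e d F -> symbol m e d G ->
  symbol m e d (fun j => F j + G j).
Proof.
elim: m d F G => [|m IH] d F G [dF bF sF] [dG bG sG];
  split => //; try exact: dominatedD; try (by move=> *; exact: differentiableD).
move=> i; under eq_fun do rewrite pderivD//.
exact: IH (sF i) (sG i).
Qed.

Lemma symbolM m e1 e2 d1 d2 F G : symbol m e1 d1 F -> symbol m e2 d2 G ->
  symbol m (e1 + e2) (d1 + d2) (fun j => F j * G j).
Proof.
elim: m d1 d2 F G => [|m IH] d1 d2 F G /[dup] SF [dF bF sF] /[dup] SG [dG bG sG];
  split => //; try exact: dominatedM; try (by move=> *; exact: differentiableM).
move=> i; under eq_fun do rewrite pderivM//.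
apply: symbolD.
  by rewrite addrAC; apply: IH (sF i) _; exact: symbol_le SG.
by rewrite -addrA; apply: IH (sG i); exact: symbol_le SF.
Qed.

Lemma dominated_cst c : dominated 0 0 (fun _ => cst c : 'rV[R]_n -> R).
Proof. by exists `|c| => j x x1; rewrite expr0 expr0z !mulr1. Qed.

Lemma symbol0 m e d : symbol m e d (fun _ => cst 0 : 'rV[R]_n -> R).
Proof.
elim: m d => [|m IH] d; split => //.
1,2: by exists 0 => j x x1; rewrite normr0 mul0r.
by move=> i; under eq_fun do rewrite pderiv_cst; exact: IH.
Qed.

Lemma symbol_cst m c : symbol m 0 0 (fun _ => cst c : 'rV[R]_n -> R).
Proof.
case: m => [|m]; split => //; try exact: dominated_cst.
by move=> i; under eq_fun do rewrite pderiv_cst; exact: symbol0.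
Qed.

Lemma symbol_dyad m : symbol m 1 0 (fun j => cst (dyad R j) : 'rV[R]_n -> R).
Proof.
have D : dominated 1 0 (fun j => cst (dyad R j) : 'rV[R]_n -> R).
  by exists 1 => j x x1; rewrite expr0z mulr1 mul1r expr1 ger0_norm// ltW// dyad_gt0.
case: m => [|m]; split => //.
by move=> i; under eq_fun do rewrite pderiv_cst; exact: symbol0.
Qed.

Lemma symbol_crd m i : symbol m 0 1 (fun _ => fun x : 'rV[R]_n => x 0 i).
Proof.
have D : dominated 0 1 (fun _ => fun x : 'rV[R]_n => x 0 i).
  by exists 1 => j x x1; rewrite mul1r expr0 mul1r expr1z crd_le_rad.
case: m => [|m]; split => //; try (by move=> *; exact: differentiable_crd).
move=> l; under eq_fun do rewrite pderiv_crd.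
by rewrite subrr; exact: symbol_cst.
Qed.

Lemma symbol_sum m e d p (F : 'I_p -> nat -> 'rV[R]_n -> R) :
  (forall l, symbol m e d (F l)) -> symbol m e d (fun j => \sum_l F l j).
Proof.
move=> sF; rewrite unlock; elim: (index_enum _) => [|l s IH] /=.
  exact: symbol0.
exact: symbolD (sF l) IH.
Qed.

Lemma symbolZ m e d c F : symbol m e d F -> symbol m e d (fun j => cst c * F j).
Proof.
by move=> sF; rewrite -[e]add0n -[d]add0r; apply: symbolM => //; exact: symbol_cst.
Qed.

End Symbols.

(** * The basic symbols *)

Section Generators.
Variables (R : realType) (n : nat).
Implicit Types (F G : nat -> 'rV[R]_n -> R) (i : 'I_n) (x : 'rV[R]_n).

Lemma sqnormE :
  @sqnorm R n = \sum_i (fun x : 'rV[R]_n => x 0 i) * (fun x => x 0 i).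
Proof. by apply/funext => x; rewrite fct_sumE. Qed.

Lemma differentiable_sqnorm x : differentiable (@sqnorm R n) x.
Proof.
rewrite sqnormE; apply: differentiable_sum => i.
by apply: differentiableM; exact: differentiable_crd.
Qed.

Lemma pderiv_sqnorm i x : pderiv i (@sqnorm R n) x = 2 * x 0 i.
Proof.
have dc l y := @differentiable_crd R n l y.
rewrite sqnormE pderiv_sum; last by move=> l y; exact: differentiableM.
under eq_bigr do rewrite pderivM// !pderiv_crd.
rewrite fct_sumE (bigD1 i)//= big1 => [|l li]; rewrite !fctE.
  by rewrite eqxx mulr1n; ring.
by rewrite eq_sym (negbTE li) mulr0n mul0r mulr0 addr0.
Qed.

Lemma differentiable_rsq j x : differentiable (@rsq R n j) x.
Proof.
apply: (@differentiableD _ _ _ (@sqnorm R n) (cst (delta R j))) => //.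
exact: differentiable_sqnorm.
Qed.

Lemma pderiv_rsq i j x : pderiv i (@rsq R n j) x = 2 * x 0 i.
Proof.
rewrite -pderiv_sqnorm.
rewrite [@rsq R n j](_ : _ = @sqnorm R n + cst (delta R j))//.
rewrite pderivD//; last exact: differentiable_sqnorm.
by rewrite pderiv_cst !fctE addr0.
Qed.

Definition rsqV (j : nat) (x : 'rV[R]_n) : R := (rsq j x)^-1.

Lemma rsq_neq0 j x : rsq j x != 0.
Proof. by rewrite gt_eqF// rsq_gt0. Qed.

Lemma pderiv_rsqV i j :
  pderiv i (rsqV j) = cst (- 2) * ((fun x => x 0 i) * (rsqV j * rsqV j)).
Proof.
apply/funext => x; have dw := differentiable_rsq j x.
rewrite pderivE ?diffV ?rsq_neq0//; last exact: differentiableV (rsq_neq0 j x).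
rewrite /= -pderivE// pderiv_rsq !fctE /rsqV.
have := rsq_neq0 j x; move: (rsq j x) => w w0.
by rewrite /GRing.scale/=; field.
Qed.

Lemma dominated_rsqV : dominated 0 (- 2) rsqV.
Proof.
exists 1 => j x x1; rewrite expr0 !mul1r /rsqV -sqr_rad ger0_norm//.
by rewrite invr_ge0 sqr_ge0.
Qed.

Lemma symbol_rsqV m : symbol m 0 (- 2) rsqV.
Proof.
have d j x : differentiable (rsqV j) x.
  exact: differentiableV (differentiable_rsq j x) (rsq_neq0 j x).
elim: m => [|m IH]; split => //; try exact: dominated_rsqV.
move=> i; under eq_fun do rewrite pderiv_rsqV.
apply: symbolZ; apply: (@symbolM _ _ _ 0 0 1 (- 2 - 2)).
  exact: symbol_crd.
exact: (symbolM IH IH).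
Qed.

(** The sign makes it positive at the origin, where it equals [1]. *)
Definition lograd (j : nat) (x : 'rV[R]_n) : R := - dyad R j * ln (rsq j x).

Lemma differentiable_lograd j x : differentiable (lograd j) x.
Proof.
apply: (@differentiableM _ _ (cst (- dyad R j)) (@ln R \o @rsq R n j)) => //.
apply: differentiable_comp; first exact: differentiable_rsq.
by apply/derivable1_diffP; apply: ex_derive; apply: is_derive1_ln; exact: rsq_gt0.
Qed.

Lemma pderiv_lograd i j : pderiv i (lograd j) =
  cst (- 2) * (cst (dyad R j) * ((fun x => x 0 i) * rsqV j)).
Proof.
rewrite [lograd j](_ : _ = cst (- dyad R j) * (@ln R \o @rsq R n j))//.
have dl x : is_derive (rsq j x) 1 (@ln R) (rsq j x)^-1.
  by apply: is_derive1_ln; exact: rsq_gt0.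
have dc x : differentiable (@ln R \o @rsq R n j) x.
  apply: differentiable_comp; first exact: differentiable_rsq.
  by apply/derivable1_diffP; exact: ex_derive.
rewrite pderivM// pderiv_cst; apply/funext => x; rewrite !fctE.
rewrite pderiv_comp; [|exact: differentiable_rsq|exact: ex_derive].
rewrite pderiv_rsq derive1E derive_val /rsqV; ring.
Qed.

(** Differentiation removes the logarithm, and the factor [dyad R j] remains. *)
Lemma symbol_pderiv_lograd m i : symbol m 1 (- 1) (fun j => pderiv i (lograd j)).
Proof.
under eq_fun do rewrite pderiv_lograd.
apply: symbolZ; apply: (@symbolM _ _ _ 1 0 0 (- 1)); first exact: symbol_dyad.
apply: (@symbolM _ _ _ 0 0 1 (- 2)); first exact: symbol_crd.
exact: symbol_rsqV.
Qed.

(** The first two bounds make [lograd] bounded; the last one trades the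
    logarithm for a power of [rad] and keeps the small factor. *)
Lemma ln_rsq_bounds j x : sqnorm x <= 1 ->
  [/\ - (dyad R j)^-1 <= ln (rsq j x), ln (rsq j x) <= 1 &
      - ln (rsq j x) <= 2 * (rad j x)^-1].
Proof.
move=> x1; split.
- have -> : - (dyad R j)^-1 = ln (delta R j) by rewrite expRK.
  by rewrite ler_ln ?posrE ?delta_gt0 ?rsq_gt0// lerDr sqnorm_ge0.
- have := @le_ln1Dx R (rsq j x - 1); rewrite subrKC => /(_ _)/le_trans; apply.
    by have := rsq_gt0 j x; lra.
  by have := delta_le1 R j; rewrite /rsq; lra.
- rewrite -sqr_rad lnXn ?rad_gt0// -mulNrn -lnV ?posrE ?rad_gt0//.
  rewrite mulr2n -[2]/(1 + 1) mulrDl !mul1r.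
  by rewrite lerD// ltW// ln_sublinear// invr_gt0 rad_gt0.
Qed.

Lemma dominated_lograd : dominated 0 0 lograd.
Proof.
exists 1 => j x x1; have [lo hi _] := ln_rsq_bounds j x1.
rewrite expr0 expr0z !mulr1 /lograd normrM normrN (gtr0_norm (dyad_gt0 R j)).
have l0 := dyad_gt0 R j; have l1 := dyad_le1 R j.
rewrite mulrC -ler_pdivlMr// mul1r ler_norml lo/=.
by apply: (le_trans hi); rewrite invf_ge1.
Qed.

Lemma dominated_lograd_small : dominated 1 (- 1) lograd.
Proof.
exists 2 => j x x1; have [_ hi lo] := ln_rsq_bounds j x1.
rewrite expr1 exprN1 /lograd normrM normrN (gtr0_norm (dyad_gt0 R j)) mulrCA.
have r0 := rad_gt0 j x; have r2 := rad_le2 j x1.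
rewrite ler_wpM2l ?(ltW (dyad_gt0 _ _))// ler_norml lerNl lo/=.
by apply: (le_trans hi); rewrite ler_pdivlMr// mul1r.
Qed.

(** The normalised logarithm belongs to two classes: it is bounded, and it is
    small at the cost of one power of [rad]. The first is needed where it
    multiplies a derivative of the harmonic polynomial, the second where the
    cutoff is differentiated, which provides the missing power. *)
Lemma symbol_lograd m : symbol m 0 0 lograd.
Proof.
case: m => [|m]; split => //;
  try exact: differentiable_lograd; try exact: dominated_lograd.
by move=> i; apply: symbol_weaken (symbol_pderiv_lograd m i).
Qed.

Lemma symbol_lograd_small m : symbol m 1 (- 1) lograd.
Proof.
case: m => [|m]; split => //;
  try exact: differentiable_lograd; try exact: dominated_lograd_small.
by move=> i; apply: symbol_weaken (symbol_pderiv_lograd m i).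
Qed.

(** When [s] and [t] have the same sign the remainder is [(s - t) ^+ 2] or [0];
    otherwise both are at most [`|s - t|] in absolute value. *)
Lemma sqr_max0_taylor (s t : R) :
  - (s - t) ^+ 2 <=
    Num.max 0 s ^+ 2 - (Num.max 0 t ^+ 2 + 2 * Num.max 0 t * (s - t)) <=
  (s - t) ^+ 2.
Proof.
have st := sqr_ge0 (s - t); have s2 := sqr_ge0 s; have t2 := sqr_ge0 t.
by apply/andP; split; case: (leP 0 s); case: (leP 0 t) => t0 s0;
  rewrite ?expr2 in st s2 t2 *; nra.
Qed.

Lemma is_derive_maxX (m : nat) (t : R) :
  is_derive t 1 (fun s : R => Num.max 0 s ^+ m.+2)
    (m.+2%:R * Num.max 0 t ^+ m.+1).
Proof.
elim: m => [|m IH].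
  set p := Num.max 0 t.
  pose g s := Num.max 0 s ^+ 2 - (p ^+ 2 + (2 * p) * (s - t)).
  have [|dg g0] := @diff_quadratic R R R g 1 t.
    apply: (@filterE _ (nbhs t)) => s; rewrite /g /p mul1r real_normK ?num_real//.
    by rewrite ler_norml sqr_max0_taylor.
  have -> : (fun s : R => Num.max 0 s ^+ 2) =
      g + (cst (p ^+ 2 - 2 * p * t) + (2 * p) *: id).
    by apply/funext => s; rewrite !fctE /g /GRing.scale/=; ring.
  have ig : is_derive t 1 g 0.
    by apply: DeriveDef; [exact: diff_derivable|rewrite deriveE// g0].
  have := is_deriveD ig (is_deriveD (is_derive_cst (p ^+ 2 - 2 * p * t) t 1)
    (is_deriveZ (2 * p) (is_derive_id t 1))).
  by rewrite !add0r expr1 /GRing.scale/= mulr1.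
have -> : (fun s : R => Num.max 0 s ^+ m.+3) =
    (fun s : R => Num.max 0 s ^+ m.+2) * id.
  apply/funext => s; rewrite !fctE.
  by case: (leP 0 s) => s0; [exact: exprSr|rewrite !expr0n/= mul0r].
have := is_deriveM IH (is_derive_id t 1).
congr is_derive; rewrite /GRing.scale/= mulr1.
case: (leP 0 t) => t0; last by rewrite !expr0n/= !mulr0 addr0.
by rewrite !exprS -(natr1 m.+2); ring.
Qed.

(** A power of a positive part rather than a smooth bump: its derivatives are
    of the same form, and finite smoothness is enough. *)
Definition cutoff (m : nat) (x : 'rV[R]_n) : R := Num.max 0 (1 - sqnorm x) ^+ m.

Lemma differentiable_cutoff m x : differentiable (cutoff m.+2) x.
Proof.
apply: (@differentiable_comp _ _ R R (fun y => 1 - sqnorm y)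
  (fun s : R => Num.max 0 s ^+ m.+2)).
  rewrite (_ : (fun y => _) = cst 1 - @sqnorm R n)//.
  apply: differentiableB => //; exact: differentiable_sqnorm.
by apply/derivable1_diffP; have [] := is_derive_maxX m (1 - sqnorm x).
Qed.

Lemma pderiv_cutoff i m : pderiv i (cutoff m.+2) =
  cst (- 2 * m.+2%:R) * ((fun x => x 0 i) * cutoff m.+1).
Proof.
apply/funext => x.
have ds y := differentiable_sqnorm y.
have E1 : (fun y : 'rV[R]_n => 1 - sqnorm y) = cst 1 - @sqnorm R n by [].
have d1 : differentiable (fun y => 1 - sqnorm y) x.
  by rewrite E1; exact: differentiableB.
rewrite [cutoff m.+2](_ : _ = (fun s : R => Num.max 0 s ^+ m.+2)
  \o (fun y => 1 - sqnorm y))//.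
have [dm dmE] := is_derive_maxX m (1 - sqnorm x).
rewrite pderiv_comp// derive1E dmE.
have -> : pderiv i (fun y : 'rV[R]_n => 1 - sqnorm y) x = - pderiv i (@sqnorm R n) x.
  rewrite /pderiv E1 deriveB; [|exact: derivable_cst|exact: diff_derivable].
  by rewrite derive_cst sub0r.
rewrite pderiv_sqnorm !mulfE /cutoff /cst.
move: (m.+2%:R : R) (Num.max _ _ ^+ _) (x 0 i) => a b c.
by rewrite mulrN !mulNr; congr (- _); ring.
Qed.

Lemma dominated_cutoff m : dominated 0 0 (fun _ => cutoff m).
Proof.
exists 1 => j x x1; rewrite expr0 expr0z !mulr1 /cutoff.
have s0 := sqnorm_ge0 x.
rewrite max_r ?subr_ge0// ger0_norm ?exprn_ge0 ?subr_ge0//.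
by rewrite exprn_ile1 ?subr_ge0// gerBl.
Qed.

Lemma symbol_cutoff m p : (m.+2 <= p)%N -> symbol m 0 0 (fun _ => cutoff p).
Proof.
elim: m p => [|m IH] [|[|p]]// mp; split => //;
  try exact: dominated_cutoff; try (by move=> *; exact: differentiable_cutoff).
move=> i; rewrite /= pderiv_cutoff.
apply: symbolZ; apply: (@symbol_weaken _ _ _ (0 + 0) 0 (1 + 0)) => //.
by apply: symbolM; [exact: symbol_crd|exact: IH].
Qed.

End Generators.

(** * Iterated derivatives and harmonic polynomials *)

Section IteratedDerivatives.
Variables (R : realType) (n : nat).
Implicit Types (f g : 'rV[R]_n -> R) (s : seq 'I_n).

Lemma pderivs_rcons f s i : pderivs (rcons s i) f = pderivs s (pderiv i f).
Proof. exact: foldr_rcons. Qed.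

Lemma pderivs0 s : pderivs s (cst 0 : 'rV[R]_n -> R) = cst 0.
Proof. by elim: s => //= i s ->; exact: pderiv_cst. Qed.

Lemma times_differentiable_le m m' f : (m' <= m)%N ->
  times_differentiable m f -> times_differentiable m' f.
Proof. by move=> mm' df s sm; apply: df; exact: leq_trans mm'. Qed.

Lemma pderivsD f g s : times_differentiable (size s) f ->
  times_differentiable (size s) g ->
  pderivs s (f + g) = pderivs s f + pderivs s g.
Proof.
elim: s => //= i s IH df dg; rewrite IH.
- by rewrite pderivD//; [exact: df|exact: dg].
- exact: times_differentiable_le df.
- exact: times_differentiable_le dg.
Qed.

Lemma pderivsZ c f s : times_differentiable (size s) f ->
  pderivs s (cst c * f) = cst c * pderivs s f.
Proof.
elim: s => //= i s IH df; rewrite IH; last exact: times_differentiable_le df.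
by rewrite pderivZ//; exact: df.
Qed.

Lemma symbol_pderivs m e d (F : nat -> 'rV[R]_n -> R) s : (size s <= m)%N ->
  symbol m e d F ->
  symbol (m - size s) e (d - (size s)%:Z) (fun j => pderivs s (F j)).
Proof.
elim/last_ind: s m d F => [|s i IH] m d F.
  by rewrite subn0 subr0.
rewrite size_rcons; case: m => // m sm [_ _ /(_ i)/(IH _ _ _ sm)].
rewrite subSS -addrA -opprD -intS.
by under [X in _ -> symbol _ _ _ X]eq_fun do rewrite pderivs_rcons.
Qed.

Lemma symbol_differentiable m e d (F : nat -> 'rV[R]_n -> R) j x :
  symbol m e d F -> differentiable (F j) x.
Proof. by case: m => [|m] [dF _ _]; exact: dF. Qed.

Lemma symbol_dominated m e d (F : nat -> 'rV[R]_n -> R) :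
  symbol m e d F -> dominated e d F.
Proof. by case: m => [|m] []. Qed.

Lemma symbol_times_differentiable m e d (F : nat -> 'rV[R]_n -> R) j :
  symbol m e d F -> times_differentiable m.+1 (F j).
Proof.
by move=> sF s sm x; apply: symbol_differentiable (symbol_pderivs sm sF).
Qed.

Lemma pderivs_laplacian m f s : times_differentiable m.+2 f ->
  (size s <= m)%N ->
  pderivs s (laplacian f) = \sum_i pderivs (s ++ [:: i; i]) f.
Proof.
move=> df sm.
have -> : laplacian f = \sum_i pderivs [:: i; i] f.
  by apply/funext => x; rewrite fct_sumE.
elim: s sm => [|l s IH] //= sm; rewrite IH ?(ltnW sm)// pderiv_sum//.
by move=> i x; apply: df; rewrite size_cat addn2 !ltnS.
Qed.

End IteratedDerivatives.

Section Harmonic.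
Variables (R : realType) (n : nat) (i0 i1 : 'I_n).

Let crd l : 'rV[R]_n -> R := fun x => x 0 l.

(** Real and imaginary parts of [(x_i0 + i x_i1) ^ m]. *)
Fixpoint zpow (m : nat) : ('rV[R]_n -> R) * ('rV[R]_n -> R) :=
  if m is m'.+1 then
    (crd i0 * (zpow m').1 + cst (- 1) * (crd i1 * (zpow m').2),
     crd i0 * (zpow m').2 + crd i1 * (zpow m').1)
  else (cst 1, cst 0).

Lemma symbol_zpow p m :
  symbol p 0 m%:Z (fun _ => (zpow m).1) /\ symbol p 0 m%:Z (fun _ => (zpow m).2).
Proof.
elim: m => [|m [sA sB]] /=; first by split; exact: symbol_cst.
have sc := symbol_crd R p; rewrite intS; split.
  apply: symbolD; first exact: (@symbolM _ _ _ 0 0 1 m _ _ (sc _ i0) sA).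
  exact: (@symbolZ _ _ _ _ _ _ _ (@symbolM _ _ _ 0 0 1 m _ _ (sc _ i1) sB)).
apply: symbolD; first exact: (@symbolM _ _ _ 0 0 1 m _ _ (sc _ i0) sB).
exact: (@symbolM _ _ _ 0 0 1 m _ _ (sc _ i1) sA).
Qed.

Lemma differentiable_zpow1 m x : differentiable (zpow m).1 x.
Proof. by have [sA _] := symbol_zpow 0 m; exact: symbol_differentiable 0 _ sA. Qed.

Lemma differentiable_zpow2 m x : differentiable (zpow m).2 x.
Proof. by have [_ sB] := symbol_zpow 0 m; exact: symbol_differentiable 0 _ sB. Qed.

(** The complex derivative of [z ^ m.+1] is [m.+1 * z ^ m], and [z] has
    derivative [1] along [i0], the imaginary unit along [i1]. *)
Lemma pderiv_zpow m l x :
  pderiv l (zpow m.+1).1 x = m.+1%:R *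
    ((l == i0)%:R * (zpow m).1 x - (l == i1)%:R * (zpow m).2 x) /\
  pderiv l (zpow m.+1).2 x = m.+1%:R *
    ((l == i0)%:R * (zpow m).2 x + (l == i1)%:R * (zpow m).1 x).
Proof.
have dA := differentiable_zpow1; have dB := differentiable_zpow2.
have dc i y : differentiable (crd i) y by exact: differentiable_crd.
have S p : pderiv l (zpow p.+1).1 x =
    (l == i0)%:R * (zpow p).1 x + x 0 i0 * pderiv l (zpow p).1 x
    - ((l == i1)%:R * (zpow p).2 x + x 0 i1 * pderiv l (zpow p).2 x) /\
  pderiv l (zpow p.+1).2 x =
    (l == i0)%:R * (zpow p).2 x + x 0 i0 * pderiv l (zpow p).2 x
    + ((l == i1)%:R * (zpow p).1 x + x 0 i1 * pderiv l (zpow p).1 x).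
  have M i f : (forall y, differentiable f y) ->
      pderiv l (crd i * f) x = (l == i)%:R * f x + x 0 i * pderiv l f x.
    by move=> df; rewrite pderivM// addfE !mulfE pderiv_crd.
  have dM i f : (forall y, differentiable f y) ->
      forall y, differentiable (crd i * f) y.
    by move=> df y; exact: differentiableM.
  split; rewrite pderivD ?addfE ?M//; try exact: dM.
    rewrite pderivM//; last exact: dM.
    by rewrite pderiv_cst addfE !mulfE M// mul0r add0r mulN1r.
  by move=> y; apply: differentiableM => //; exact: dM.
elim: m => [|m [IA IB]].
  have [-> ->] := S 0%N; rewrite /= !pderiv_cst !mulr0 !addr0 !mul1r.
  by [].
have [-> ->] := S m.+1; rewrite IA IB -(natr1 m.+1).
have -> : (zpow m.+1).1 x = x 0 i0 * (zpow m).1 x + - 1 * (x 0 i1 * (zpow m).2 x).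
  by [].
have -> : (zpow m.+1).2 x = x 0 i0 * (zpow m).2 x + x 0 i1 * (zpow m).1 x.
  by [].
by split; ring.
Qed.

(** Twice along [i0] and twice along [i1], the second derivatives of [z ^ m.+2]
    differ by the square of the imaginary unit. *)
Lemma laplacian_zpow m x : i0 != i1 -> laplacian (zpow m.+2).1 x = 0.
Proof.
move=> i01; rewrite /laplacian.
have dA := differentiable_zpow1; have dB := differentiable_zpow2.
have E l : pderiv l (pderiv l (zpow m.+2).1) x =
    m.+2%:R * m.+1%:R * ((l == i0)%:R - (l == i1)%:R) * (zpow m).1 x.
  have -> : pderiv l (zpow m.+2).1 = cst (m.+2%:R * (l == i0)%:R) * (zpow m.+1).1 +
      cst (- (m.+2%:R * (l == i1)%:R)) * (zpow m.+1).2.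
    apply/funext => y; have [-> _] := pderiv_zpow m.+1 l y.
    by rewrite addfE !mulfE /cst; ring.
  rewrite pderivD; try by move=> y; exact: differentiableM.
  rewrite !pderivZ// addfE !mulfE.
  have [-> ->] := pderiv_zpow m l x; rewrite /cst.
  have : (l == i0)%:R * (l == i1)%:R = 0 :> R.
    by case: eqP => [->|]; rewrite ?(negbTE i01) ?mulr0 ?mul0r.
  have : (l == i0)%:R * (l == i0)%:R = (l == i0)%:R :> R.
    by case: eqP; rewrite ?mulr1 ?mulr0.
  have : (l == i1)%:R * (l == i1)%:R = (l == i1)%:R :> R.
    by case: eqP; rewrite ?mulr1 ?mulr0.
  move: (m.+2%:R : R) (m.+1%:R : R) ((l == i0)%:R : R) ((l == i1)%:R : R).
  move=> p q a b bb aa ab; rewrite ?mul0r ?add0r.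
  transitivity (p * q *
    ((a * a - b * b) * (zpow m).1 x - 2 * (a * b) * (zpow m).2 x)).
    by ring.
  by rewrite ab aa bb; ring.
under eq_bigr do rewrite E.
have D i : \sum_(l < n) (l == i)%:R = 1 :> R.
  by rewrite (bigD1 i)//= eqxx big1 ?addr0// => l /negbTE ->.
by rewrite -mulr_suml -mulr_sumr sumrB !D subrr mulr0 mul0r.
Qed.

End Harmonic.

(** * The profile of one bump *)

Section Profile.
Variables (R : realType) (n : nat) (i0 i1 : 'I_n) (N : nat).

(** Equal to [1] at the origin and [0] outside the unit ball, descending so
    slowly that the derivatives of order [m] are [O(dyad R j * rad ^- m)]. *)
Definition plateau (j : nat) : 'rV[R]_n -> R := lograd j * cutoff N.

Lemma symbol_plateau m : (m.+2 <= N)%N -> symbol m 0 0 plateau.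
Proof.
move=> mN; apply: (@symbolM _ _ _ 0 0 0 0); first exact: symbol_lograd.
exact: symbol_cutoff.
Qed.

(** Both terms of the product rule are small: the logarithm has a small gradient,
    and the gradient of the cutoff vanishes at the origin, which compensates the
    power of [rad] lost by [symbol_lograd_small]. *)
Lemma symbol_pderiv_plateau m i : (m.+3 <= N)%N ->
  symbol m 1 (- 1) (fun j => pderiv i (plateau j)).
Proof.
move=> mN.
have NE : N = N.-2.+2 by lia.
have dc x : differentiable (cutoff N) x by rewrite NE; exact: differentiable_cutoff.
have dl j x := @differentiable_lograd R n j x.
under eq_fun do rewrite /plateau pderivM//.
apply: symbolD.
  apply: (@symbolM _ _ _ 1 0 (- 1) 0); first exact: symbol_pderiv_lograd.
  by apply: symbol_cutoff; lia.
rewrite NE pderiv_cutoff.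
apply: (@symbol_weaken _ _ _ (1 + (0 + (0 + 0))) 1 (- 1 + (0 + (1 + 0)))) => //.
apply: symbolM; first exact: symbol_lograd_small.
apply: symbolM; first exact: symbol_cst.
by apply: symbolM; [exact: symbol_crd|apply: symbol_cutoff; lia].
Qed.

(** Up to a small error, the [m]-th derivative along [i0] falls on the polynomial
    only: when one derivative falls on [plateau], the small factor appears, and
    the order is still [0] after the remaining derivatives. *)
Lemma iter_pderiv_zpow_plateau m p : i0 != i1 -> (m + p + 3 <= N)%N ->
  symbol p 1 0 (fun j => pderivs (nseq m i0) ((zpow R i0 i1 m).1 * plateau j)
    + cst (- m`!%:R) * plateau j).
Proof.
move=> i01; elim: m p => [|m IH] p mN.
  rewrite (_ : (fun j => _) = (fun=> cst 0)); first exact: symbol0.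
  apply/funext => j; apply/funext => x.
  by rewrite addfE !mulfE /= mul1r mulN1r subrr.
have [sA _] := symbol_zpow R i0 i1 (m + p) m.
have [sA' _] := symbol_zpow R i0 i1 (m + p) m.+1.
have sH : symbol (m + p) 0 0 plateau by apply: symbol_plateau; lia.
have sdH : symbol (m + p) 1 (- 1) (fun j => pderiv i0 (plateau j)).
  by apply: symbol_pderiv_plateau; lia.
have sAH := symbolM sA sH; have sAdH := symbolM sA' sdH.
have E j : pderivs (nseq m.+1 i0) ((zpow R i0 i1 m.+1).1 * plateau j)
      + cst (- (m.+1)`!%:R) * plateau j =
    cst m.+1%:R * (pderivs (nseq m i0) ((zpow R i0 i1 m).1 * plateau j)
      + cst (- m`!%:R) * plateau j)
    + pderivs (nseq m i0) ((zpow R i0 i1 m.+1).1 * pderiv i0 (plateau j)).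
  have td1 : times_differentiable m ((zpow R i0 i1 m).1 * plateau j).
    apply: times_differentiable_le (symbol_times_differentiable j sAH); lia.
  have -> : nseq m.+1 i0 = rcons (nseq m i0) i0 by rewrite -addn1 nseqD cats1.
  rewrite pderivs_rcons pderivM; last 2 first.
  - exact: differentiable_zpow1.
  - by move=> x; exact: symbol_differentiable sH.
  have -> : pderiv i0 (zpow R i0 i1 m.+1).1 = cst m.+1%:R * (zpow R i0 i1 m).1.
    apply/funext => x; have [-> _] := pderiv_zpow i0 i1 m i0 x.
    by rewrite mulfE eqxx (negbTE i01) mulr1n mul1r mul0r subr0.
  have -> : cst m.+1%:R * (zpow R i0 i1 m).1 * plateau j =
      cst m.+1%:R * ((zpow R i0 i1 m).1 * plateau j).
    by apply/funext => x; rewrite !mulfE mulrA.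
  have td2 : times_differentiable m (cst m.+1%:R * ((zpow R i0 i1 m).1 * plateau j)).
    have := symbol_times_differentiable j (symbolZ m.+1%:R sAH).
    by apply: times_differentiable_le; lia.
  have td3 : times_differentiable m ((zpow R i0 i1 m.+1).1 * pderiv i0 (plateau j)).
    apply: times_differentiable_le (symbol_times_differentiable j sAdH); lia.
  rewrite pderivsD ?size_nseq// pderivsZ ?size_nseq//.
  apply/funext => x; rewrite !(addfE, mulfE) /cst factS natrM.
  by ring.
under eq_fun do rewrite E.
apply: symbolD; first by apply: symbolZ; apply: IH; lia.
have sm : (size (nseq m i0) <= m + p)%N by rewrite size_nseq leq_addr.
have := symbol_pderivs sm sAdH; rewrite size_nseq addKn.
by apply: symbol_weaken => //; lia.
Qed.

Lemma plateau0 j : plateau j 0 = 1.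
Proof.
have s0 : sqnorm (0 : 'rV[R]_n) = 0.
  by apply: big1 => i _; rewrite mxE expr0n.
rewrite /plateau mulfE /lograd /cutoff /rsq s0 add0r subr0.
rewrite max_r ?ler01// expr1n mulr1.
by rewrite /delta expRK mulrNN divff// gt_eqF// dyad_gt0.
Qed.

End Profile.

Section ProfileEstimates.
Variables (R : realType) (n k : nat) (i0 i1 : 'I_n).

(** The exponent of the cutoff only has to be large enough for the number of
    derivatives taken. *)
Definition profile (j : nat) : 'rV[R]_n -> R :=
  (zpow R i0 i1 k.+2).1 * plateau (k + 10) j.

Lemma symbol_profile : symbol (k + 7) 0 (k.+2)%:Z profile.
Proof.
have [sA _] := symbol_zpow R i0 i1 (k + 7) k.+2.
have sH : symbol (k + 7) 0 0 (@plateau R n (k + 10)) by apply: symbol_plateau; lia.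
by have := symbolM sA sH; rewrite addr0.
Qed.

Lemma profile_smooth j : times_differentiable k.+4 (profile j).
Proof.
apply: times_differentiable_le (symbol_times_differentiable j symbol_profile).
by lia.
Qed.

(** By harmonicity the term in which the polynomial is differentiated twice
    disappears; the others contain a derivative of [plateau]. *)
Lemma laplacian_profileE j : i0 != i1 -> laplacian (profile j) =
  \sum_i (cst 2 * (pderiv i (zpow R i0 i1 k.+2).1 * pderiv i (plateau (k + 10) j))
    + (zpow R i0 i1 k.+2).1 * pderiv i (pderiv i (plateau (k + 10) j))).
Proof.
move=> i01; pose A := (zpow R i0 i1 k.+2).1.
pose H : 'rV[R]_n -> R := plateau (k + 10) j.
have [sA _] := symbol_zpow R i0 i1 1 k.+2.
have sH : symbol 1 0 0 (@plateau R n (k + 10)) by apply: symbol_plateau; lia.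
have dA x : differentiable A x by exact: symbol_differentiable 0 _ sA.
have dH x : differentiable H x by exact: symbol_differentiable sH.
have dA' i x : differentiable (pderiv i A) x.
  by case: sA => _ _ /(_ i)[d _ _]; exact: d 0%N x.
have dH' i x : differentiable (pderiv i H) x.
  by case: sH => _ _ /(_ i)[d _ _]; exact: d.
have L : forall x, laplacian A x = 0 by move=> x; exact: laplacian_zpow.
apply/funext => x; rewrite fct_sumE /laplacian.
have E i : pderiv i (pderiv i (profile j)) x = pderiv i (pderiv i A) x * H x +
    (cst 2 * (pderiv i A * pderiv i H) + A * pderiv i (pderiv i H)) x.
  by rewrite /profile -/A -/H pderiv2M.
under eq_bigr do rewrite E.
by rewrite big_split/= -mulr_suml [X in X * _]L mul0r add0r.
Qed.

(** The order [k] is [(k + 1) - 1] for the mixed term and [(k + 2) - 2] for the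
    other; the small factor comes from [symbol_pderiv_plateau]. *)
Lemma symbol_laplacian_profile : i0 != i1 ->
  symbol k 1 k%:Z (fun j => laplacian (profile j)).
Proof.
move=> i01; under eq_fun do rewrite laplacian_profileE//.
apply: symbol_sum => i.
have [sA _] := symbol_zpow R i0 i1 k.+1 k.+2.
have sH : symbol k.+1 1 (- 1) (fun j => pderiv i (@plateau R n (k + 10) j)).
  by apply: symbol_pderiv_plateau; lia.
apply: symbolD.
  apply: (@symbolZ _ _ _ _ _ _ (fun j =>
    pderiv i (zpow R i0 i1 k.+2).1 * pderiv i (plateau (k + 10) j))).
  apply: (@symbol_weaken _ _ _ (0 + 1) 1 ((k.+2)%:Z - 1 + - 1)); [by []|by lia|].
  apply: symbolM; first by have [_ _] := sA; apply.
  by apply: symbol_le sH.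
apply: (@symbol_weaken _ _ _ (0 + 1) 1 ((k.+2)%:Z + (- 1 - 1))); [by []|by lia|].
apply: symbolM; first by apply: symbol_le sA.
by have [_ _] := sH; apply.
Qed.

Lemma sqnorm_lt1 (x : 'rV[R]_n) : sqnorm x < 1 -> `|x| < 1.
Proof.
move=> x1; rewrite [`|x|]mx_normrE; apply: bigmax_lt => // -[a i] _ /=.
rewrite (ord1 a) -(@ltr_pXn2r _ 2)// ?nnegrE// expr1n real_normK ?num_real//.
apply: le_lt_trans x1; rewrite /sqnorm (bigD1 i)//= lerDl.
by apply: sumr_ge0 => l _; exact: sqr_ge0.
Qed.

Lemma profile_out j x : 1 <= sqnorm x -> profile j x = 0.
Proof.
move=> x1; rewrite /profile /plateau !mulfE /cutoff max_l ?subr_le0// addnS expr0n/=.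
by rewrite !mulr0.
Qed.

Lemma profile_norm_out j x : 1 <= `|x| -> profile j x = 0.
Proof.
move=> x1; apply: profile_out; rewrite leNgt.
by apply: contraTN x1 => /sqnorm_lt1; rewrite -ltNge.
Qed.

(** The bounds on symbols hold on the unit ball only, but the profile vanishes
    outside it. *)
Lemma pderivs_profile_out j x s : 1 < sqnorm x -> pderivs s (profile j) x = 0.
Proof.
move=> x1; have : \forall y \near x, profile j y = cst 0 y.
  have /cvgr_gt/(_ _ x1) := differentiable_continuous (@differentiable_sqnorm R n x).
  by apply: filterS => y /= /ltW; exact: profile_out.
by move=> /(@near_pderivs _ _ _ _ _ s)/nbhs_singleton ->; rewrite pderivs0.
Qed.

Lemma symbol_bounded m e d (F : nat -> 'rV[R]_n -> R) : (0 <= d)%R ->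
  symbol m e d F ->
  exists C, forall j x, sqnorm x <= 1 -> `|F j x| <= C * dyad R j ^+ e.
Proof.
move=> d0 /symbol_dominated/(@dominated_weaken _ _ e e d 0 _ (leqnn _) d0)[C FC].
by exists C => j x x1; rewrite -[_ ^+ _]mulr1 -(expr0z (rad j x)) FC.
Qed.

Lemma pderivs_profile_le s : (size s <= k.+2)%N ->
  exists C, 0 <= C /\ forall j x, `|pderivs s (profile j) x| <= C.
Proof.
move=> sk; have sk7 : (size s <= k + 7)%N by lia.
have [|C bC] := symbol_bounded _ (symbol_pderivs sk7 symbol_profile); first by lia.
exists `|C|; split => // j x; have [x1|x1] := leP (sqnorm x) 1.
  by apply: (le_trans (bC j x x1)); rewrite expr0 mulr1 ler_norm.
by rewrite pderivs_profile_out// normr0.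
Qed.

Lemma pderivs_laplacian_profile_le s : i0 != i1 -> (size s <= k)%N ->
  exists C, 0 <= C /\
    forall j x, `|pderivs s (laplacian (profile j)) x| <= C * dyad R j.
Proof.
move=> i01 sk.
have [|C bC] := symbol_bounded _ (symbol_pderivs sk (symbol_laplacian_profile i01)).
  by lia.
exists `|C|; split => // j x; have [x1|x1] := leP (sqnorm x) 1.
  apply: (le_trans (bC j x x1)); rewrite expr1 ler_wpM2r ?ler_norm//.
  exact/ltW/dyad_gt0.
rewrite (@pderivs_laplacian _ _ k.+2)//; [|exact: profile_smooth|by lia].
rewrite fct_sumE big1 ?normr0 ?mulr_ge0 ?(ltW (dyad_gt0 _ _))// => i _.
exact: pderivs_profile_out.
Qed.

(** This is [iter_pderiv_zpow_plateau] at the origin, where [plateau] is [1]. *)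
Lemma pderivs_profile0 : i0 != i1 ->
  exists C, forall j,
    `|pderivs (nseq k.+2 i0) (profile j) 0 - (k.+2)`!%:R| <= C * dyad R j.
Proof.
move=> i01; have kN : (k.+2 + 0 + 3 <= k + 10)%N by lia.
have [|C bC] := symbol_bounded _ (iter_pderiv_zpow_plateau R i01 kN); first by [].
exists C => j; have := bC j 0.
rewrite /sqnorm big1 => [/(_ ler01)|i _]; last by rewrite mxE expr0n.
by rewrite addfE mulfE plateau0 mulr1 expr1.
Qed.

End ProfileEstimates.

(** * Rescaling and gluing *)

Section Rescaling.
Variables (R : realType) (n : nat).
Implicit Types (g : 'rV[R]_n -> R) (a : 'rV[R]_n).

Lemma is_diff_affine (t : R) a x :
  is_diff x (fun y : 'rV[R]_n => t *: (y - a)) (fun v => t *: v).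
Proof.
rewrite (_ : (fun y => _) = t *: (id - cst a))//.
by apply: is_diff_eq; apply/funext => v; rewrite !fctE subr0.
Qed.

Lemma differentiable_rescale g c (t : R) a x : (forall y, differentiable g y) ->
  differentiable (fun y => c * g (t *: (y - a))) x.
Proof.
move=> dg.
apply: (@differentiableM _ _ (cst c) (g \o (fun y => t *: (y - a)))) => //.
by apply: differentiable_comp => //; have [] := is_diff_affine t a x.
Qed.

Lemma pderiv_rescale g c (t : R) a i : (forall x, differentiable g x) ->
  pderiv i (fun x => c * g (t *: (x - a))) =
  (fun x => c * t * pderiv i g (t *: (x - a))).
Proof.
move=> dg; pose h x : 'rV[R]_n := t *: (x - a).
have dgh x : differentiable (g \o h) x.
  by apply: differentiable_comp => //; have [] := is_diff_affine t a x.
have -> : (fun x => c * g (t *: (x - a))) = cst c * (g \o h) by [].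
rewrite pderivZ//; apply/funext => x; rewrite mulfE -mulrA; congr (_ * _).
have [dh dhE] := is_diff_affine t a x.
have dE : 'd (g \o h) x = 'd g (h x) \o 'd h x :> ('rV[R]_n -> R).
  exact: diff_comp.
rewrite (pderivE i (dgh x)) dE (pderivE i (dg _)).
have hE : 'd h x (delta_mx 0 i) = t *: delta_mx 0 i.
  by rewrite [LHS](congr1 (fun f => f _) dhE).
rewrite -[LHS]/('d g (h x) ('d h x (delta_mx 0 i))).
by rewrite hE linearZ.
Qed.

Lemma pderivs_rescale g c (t : R) a s : times_differentiable (size s) g ->
  pderivs s (fun x => c * g (t *: (x - a))) =
  (fun x => c * t ^+ size s * pderivs s g (t *: (x - a))).
Proof.
elim: s => [|i s IH] /= dg; first by rewrite expr0 mulr1.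
rewrite IH; last exact: times_differentiable_le dg.
by rewrite pderiv_rescale ?exprSr ?mulrA//; exact: dg.
Qed.

Lemma near_norm (x : 'rV[R]_n) (e : R) : 0 < e -> \forall y \near x, `|y - x| < e.
Proof.
move=> e0; have := nbhsx_ballx x e e0; rewrite -ball_normE.
by apply: filterS => y /=; rewrite distrC.
Qed.

End Rescaling.

Section Gluing.
Variables (R : realType) (n k : nat) (i0 i1 : 'I_n).

Definition center (j : nat) : 'rV[R]_n := dyad R j *: delta_mx 0 i0.

(** Quadratic in the distance to the origin: this makes the derivatives of order
    [k + 1] negligible at the origin. The factor [8] makes even the balls of
    doubled radius disjoint. *)
Definition radius (j : nat) : R := dyad R j ^+ 2 / 8.

(** The factor [radius j ^+ k.+2] makes derivatives of order [k.+2] invariant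
    under the rescaling. *)
Definition piece (j : nat) : 'rV[R]_n -> R :=
  fun x => radius j ^+ k.+2 * profile k i0 i1 j ((radius j)^-1 *: (x - center j)).

Lemma radius_gt0 j : 0 < radius j.
Proof. by rewrite divr_gt0 ?exprn_gt0 ?dyad_gt0. Qed.

Lemma radius_le j : 8 * radius j <= dyad R j.
Proof.
rewrite /radius mulrCA divff ?mulr1 ?pnatr_eq0// expr2.
by rewrite ler_piMr ?dyad_le1// ltW// dyad_gt0.
Qed.

Lemma dyad_half i j : (i < j)%N -> 2 * dyad R j <= dyad R i.
Proof.
move=> ij; rewrite /dyad -ler_pdivlMl// -invfM lef_pV2 ?posrE ?mulr_gt0 ?exprn_gt0//.
by rewrite -exprS ler_eXn2l ?ltr1n.
Qed.

Lemma dyad_decr i j : (i <= j)%N -> dyad R j <= dyad R i.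
Proof.
rewrite leq_eqVlt => /predU1P[->//|/dyad_half]; have := dyad_gt0 R j; lra.
Qed.

Lemma dyad_small (e : R) : 0 < e -> exists j, dyad R j < e.
Proof.
move=> e0; exists (Num.bound e^-1); rewrite /dyad invf_plt ?posrE ?exprn_gt0//.
exact/upper_nthrootP.
Qed.

Lemma normr_delta : `|delta_mx 0 i0 : 'rV[R]_n| = 1.
Proof.
have nz : mx_norm (delta_mx 0 i0 : 'rV[R]_n) != 0.
  apply/eqP => /mx_norm_eq0/matrixP/(_ 0 i0).
  by rewrite !mxE !eqxx => /eqP; rewrite oner_eq0.
have [[a l] /= E] := mx_norm_neq0 nz; rewrite [LHS]E; move: nz; rewrite E mxE.
by case: (_ && _); rewrite ?normr1// normr0 eqxx.
Qed.

Lemma normr_center j : `|center j| = dyad R j.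
Proof. by rewrite normrZ normr_delta mulr1 gtr0_norm ?dyad_gt0. Qed.

Lemma piece_out j x : radius j <= `|x - center j| -> piece j x = 0.
Proof.
move=> xj; rewrite /piece profile_norm_out ?mulr0//.
rewrite normrZ ger0_norm ?invr_ge0 ?(ltW (radius_gt0 _))//.
by rewrite mulrC ler_pdivlMr ?mul1r// radius_gt0.
Qed.

Lemma pderivs_piece_out j s x : radius j < `|x - center j| ->
  pderivs s (piece j) x = 0.
Proof.
move=> xj; have : \forall y \near x, piece j y = cst 0 y.
  have := @near_norm R n x (`|x - center j| - radius j).
  rewrite subr_gt0 => /(_ xj); apply: filterS => y xy; apply: piece_out.
  have : `|x - center j| <= `|x - y| + `|y - center j|.
    exact: ler_distD.
  by rewrite distrC in xy; lra.
by move=> /(@near_pderivs _ _ _ _ _ s)/nbhs_singleton ->; rewrite pderivs0.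
Qed.

Lemma pderivs_pieceE j s : (size s <= k.+4)%N -> pderivs s (piece j) =
  (fun x => radius j ^+ k.+2 * (radius j)^-1 ^+ size s *
    pderivs s (profile k i0 i1 j) ((radius j)^-1 *: (x - center j))).
Proof.
move=> sk; apply: pderivs_rescale.
exact: times_differentiable_le sk (@profile_smooth R n k i0 i1 j).
Qed.

Lemma piece_smooth j : times_differentiable k.+4 (piece j).
Proof.
move=> s sk x; rewrite (pderivs_pieceE _ (ltnW sk)).
by apply: differentiable_rescale => y; exact: profile_smooth.
Qed.

Lemma radiusX j p q : (q <= p)%N ->
  radius j ^+ p * (radius j)^-1 ^+ q = radius j ^+ (p - q).
Proof.
move=> qp; rewrite -{1}(subnK qp) exprD -mulrA exprVn mulfV ?mulr1//.
by rewrite expf_neq0// gt_eqF// radius_gt0.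
Qed.

Lemma pderivs_piece_le s : (size s <= k.+2)%N ->
  exists C, 0 <= C /\ forall j x,
    `|pderivs s (piece j) x| <= C * radius j ^+ (k.+2 - size s).
Proof.
move=> sk; have [C [C0 bC]] := pderivs_profile_le R i0 i1 sk.
exists C; split => // j x; rewrite pderivs_pieceE; last by lia.
have r0 : 0 <= radius j ^+ (k.+2 - size s) by rewrite exprn_ge0// ltW// radius_gt0.
by rewrite radiusX// normrM mulrC (ger0_norm r0) ler_wpM2r.
Qed.

Lemma radius_le1 j : radius j <= 1.
Proof. have := radius_le j; have := dyad_le1 R j; have := radius_gt0 j; lra. Qed.

Lemma pderivs_laplacian_pieceE j s x : (size s <= k)%N ->
  pderivs s (laplacian (piece j)) x = radius j ^+ (k - size s) *
    pderivs s (laplacian (profile k i0 i1 j)) ((radius j)^-1 *: (x - center j)).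
Proof.
move=> sk; have E (f : 'rV[R]_n -> R) y : times_differentiable k.+4 f ->
    pderivs s (laplacian f) y = \sum_i pderivs (s ++ [:: i; i]) f y.
  by move=> df; rewrite (pderivs_laplacian df) ?fct_sumE//; lia.
apply: etrans (E _ _ (piece_smooth j)) _.
apply/esym; apply: etrans (congr1 _ (E _ _ (@profile_smooth R n k i0 i1 j))) _.
rewrite mulr_sumr; apply: eq_bigr => i _.
have sii : size (s ++ [:: i; i]) = (size s).+2 by rewrite size_cat addn2.
rewrite pderivs_pieceE ?sii; last by lia.
by rewrite radiusX.
Qed.

Lemma pderivs_laplacian_piece_le s : i0 != i1 -> (size s <= k)%N ->
  exists C, 0 <= C /\ forall j x,
    `|pderivs s (laplacian (piece j)) x| <= C * dyad R j.
Proof.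
move=> i01 sk; have [C [C0 bC]] := pderivs_laplacian_profile_le R i01 sk.
exists C; split; first exact: C0.
move=> j x; rewrite pderivs_laplacian_pieceE//.
have r0 := ltW (radius_gt0 j); rewrite normrM (ger0_norm (exprn_ge0 _ r0)).
apply: le_trans (bC j ((radius j)^-1 *: (x - center j))).
by rewrite ler_piMl// exprn_ile1// radius_le1.
Qed.

Lemma pderivs_piece_center j : pderivs (nseq k.+2 i0) (piece j) (center j) =
  pderivs (nseq k.+2 i0) (profile k i0 i1 j) 0.
Proof.
rewrite pderivs_pieceE ?size_nseq; last by lia.
by rewrite radiusX// subnn expr0 mul1r subrr scaler0.
Qed.

(** The centres are at distance at least [dyad R i / 2], and the two doubled radii
    add up to at most that. *)
Lemma separated i j x : (i < j)%N -> `|x - center i| < 2 * radius i ->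
  `|x - center j| < 2 * radius j -> False.
Proof.
move=> ij xi xj.
have := ler_distD x (center i) (center j); have := ler_distD (center j) (center i) 0.
rewrite !subr0 (distrC (center i) x) !normr_center; have := dyad_half ij.
have := radius_le i; have := radius_le j.
have := dyad_gt0 R j; lra.
Qed.

(** The sum of all the pieces: their supports being disjoint, it is enough to pick
    the one whose ball contains [x]. When there is none, [piece 0] is evaluated
    outside its ball and gives [0]. *)
Definition glued (x : 'rV[R]_n) : R :=
  piece (xget 0%N [set j | `|x - center j| < radius j]) x.

Lemma glued_in j x : `|x - center j| < 2 * radius j -> glued x = piece j x.
Proof.
move=> xj; rewrite /glued; case: xgetP => [i _ /= xi|no].
  have xi2 : `|x - center i| < 2 * radius i by have := radius_gt0 i; lra.
  have [ij|ji|->//] := ltngtP i j.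
    by case: (separated ij xi2 xj).
  by case: (separated ji xj xi2).
by rewrite !piece_out// leNgt; apply/negP; exact: no.
Qed.

Lemma glued_out x : (forall j, radius j <= `|x - center j|) -> glued x = 0.
Proof. by move=> xo; exact/piece_out/xo. Qed.

Lemma glued_near_center j x : `|x - center j| < 2 * radius j ->
  \forall y \near x, glued y = piece j y.
Proof.
move=> xj; have := @near_norm R n x (2 * radius j - `|x - center j|).
rewrite subr_gt0 => /(_ xj); apply: filterS => y yx; apply: glued_in.
have : `|y - center j| <= `|y - x| + `|x - center j|.
  exact: ler_distD.
lra.
Qed.

(** The supports accumulate only at the origin. If [x] is in no doubled ball, then
    a neighbourhood of [x] avoids the balls of index at most [J] because it
    is smaller than their radii, and those of larger index because they are
    closer to the origin. *)
Lemma glued_local (x : 'rV[R]_n) : x != 0 ->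
  exists j, \forall y \near x, glued y = piece j y.
Proof.
move=> x0; have [[j xj]|no] := pselect (exists j, `|x - center j| < 2 * radius j).
  by exists j; exact: glued_near_center.
have far j : 2 * radius j <= `|x - center j|.
  by rewrite leNgt; apply/negP => xj; apply: no; exists j.
have nx0 : 0 < `|x| by rewrite normr_gt0.
have [J xJ] : exists J, dyad R J < `|x| / 4 by apply: dyad_small; rewrite divr_gt0.
(* Near [x] all the pieces vanish, so that any index would do. *)
exists 0%N.
have e0 : 0 < Num.min (radius J) (`|x| / 2).
  by rewrite lt_min radius_gt0 divr_gt0.
apply: filterS (near_norm x e0) => y; rewrite lt_min => /andP[yJ yx].
have out j : radius j <= `|y - center j|.
  have [jJ|Jj] := leqP j J.
    have : radius J <= radius j.
      rewrite /radius ler_pM2r ?invr_gt0// lerXn2r ?nnegrE ?(ltW (dyad_gt0 _ _))//.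
      exact: dyad_decr.
    have : `|x - center j| <= `|y - x| + `|y - center j|.
      by rewrite (distrC y x); exact: ler_distD.
    by have := far j; lra.
  have := ler_distD y x 0; have := ler_distD (center j) y 0.
  rewrite !subr0 normr_center (distrC x y).
  have := dyad_decr (ltnW Jj); have := radius_le j.
  by have := radius_gt0 j; lra.
by rewrite glued_out// piece_out.
Qed.

(** The radius is at most an eighth of the distance from the centre to the origin,
    so that all the ball stays at a comparable distance. *)
Lemma support_near0 j x : `|x - center j| <= radius j ->
  dyad R j <= 2 * `|x| /\ radius j <= `|x| ^+ 2.
Proof.
move=> xj; have := radius_le j; have d0 := dyad_gt0 R j => rj.
have := ler_distD x (center j) 0.
rewrite !subr0 normr_center (distrC _ x) => dx.
have dx2 : dyad R j <= 2 * `|x| by lra.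
split => //; have : dyad R j ^+ 2 <= (2 * `|x|) ^+ 2.
  by rewrite lerXn2r ?nnegrE ?mulr_ge0// ltW.
rewrite exprMn /radius; have := sqr_ge0 `|x|.
by move: (dyad R j ^+ 2) (`|x| ^+ 2) => a b; lra.
Qed.

End Gluing.

(** * Regularity of the glued function *)

Lemma continuous_lipschitz0 (R : realType) (V W : normedModType R) (f : V -> W) C :
  f 0 = 0 -> (forall x, `|f x| <= C * `|x|) -> {for 0, continuous f}.
Proof.
move=> f0 fC; apply/cvgrPdist_le => e e0; rewrite f0.
have C1 : 0 < `|C| + 1 by rewrite ltr_wpDl.
near=> x; rewrite sub0r normrN; apply: (le_trans (fC x)).
apply: (@le_trans _ _ ((`|C| + 1) * `|x|)).
  by rewrite ler_wpM2r// (le_trans (ler_norm C))// lerDl.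
rewrite mulrC -ler_pdivlMr//; near: x; apply/nbhs0_le; exact: divr_gt0.
Unshelve. all: by end_near. Qed.

Section GluedRegularity.
Variables (R : realType) (n k : nat) (i0 i1 : 'I_n).

Let u : 'rV[R]_n -> R := glued k i0 i1.
Let pc : nat -> 'rV[R]_n -> R := piece k i0 i1.

Lemma glued0 : u 0 = 0.
Proof.
apply: glued_out => j; rewrite sub0r normrN normr_center.
by have := radius_le R j; have := radius_gt0 R j; lra.
Qed.

Lemma pderivs_glued_local s (x : 'rV[R]_n) : x != 0 ->
  exists j, \forall y \near x, pderivs s u y = pderivs s (pc j) y.
Proof. by move=> /(glued_local k i0 i1)[j uj]; exists j; exact: near_pderivs. Qed.

(** Off the support of [piece j] there is nothing to prove; on it the radius is
    at most the squared distance to the origin. *)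
Lemma pderivs_glued_quadratic s : (size s <= k.+1)%N -> pderivs s u 0 = 0 ->
  exists C, forall x, `|pderivs s u x| <= C * `|x| ^+ 2.
Proof.
move=> sk s0; have [|C [C0 bC]] := pderivs_piece_le R i0 i1 (_ : size s <= k.+2)%N.
  by lia.
exists C => x; have [->|x0] := eqVneq x 0.
  by rewrite s0 !normr0 expr0n mulr0.
have [j /nbhs_singleton ->] := pderivs_glued_local s x0.
have [xj|xj] := ltP (radius R j) `|x - center R i0 j|.
  by rewrite pderivs_piece_out// normr0 mulr_ge0.
have [_ rx] := support_near0 xj.
apply: (le_trans (bC j x)); rewrite ler_wpM2l//; apply: le_trans rx.
rewrite subSn// exprS ler_piMr ?(ltW (radius_gt0 _ _))//.
by rewrite exprn_ile1 ?radius_le1// ltW// radius_gt0.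
Qed.

(** Each derivative of order at most [k.+1] is quadratically small at the origin,
    so that its own partial derivatives vanish there. *)
Lemma pderivs_glued0 s : (size s <= k.+2)%N -> pderivs s u 0 = 0.
Proof.
elim: s => [_|i s IH] /=; first exact: glued0.
move=> sk; have [C uC] := pderivs_glued_quadratic sk (IH (ltnW sk)).
have [|_ ->//] := @pderiv_quadratic R n (pderivs s u) C 0.
by apply: (@filterE _ (nbhs (0 : 'rV[R]_n))) => x; rewrite subr0.
Qed.

Lemma glued_smooth : times_differentiable k.+2 u.
Proof.
move=> s sk x; have [->|x0] := eqVneq x 0.
  have [C uC] := pderivs_glued_quadratic sk (pderivs_glued0 (ltnW sk)).
  have [|//] := @pderiv_quadratic R n (pderivs s u) C 0.
  by apply: (@filterE _ (nbhs (0 : 'rV[R]_n))) => y; rewrite subr0.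
have [j uj] := pderivs_glued_local s x0.
have uj' : \forall y \near x, pderivs s (pc j) y = pderivs s u y.
  by apply: filterS uj => y /esym.
by apply: near_differentiable uj' _; apply: piece_smooth; lia.
Qed.

Lemma bounded_pderivs_glued s : size s = k.+2 -> bounded_fun (pderivs s u).
Proof.
move=> sk; have [|C [C0 bC]] := pderivs_piece_le R i0 i1 (_ : size s <= k.+2)%N.
  by rewrite sk.
exists C; split; first exact: num_real.
move=> M CM x _; apply: le_trans (ltW CM).
have [->|x0] := eqVneq x 0; first by rewrite pderivs_glued0 ?sk// normr0.
have [j /nbhs_singleton ->] := pderivs_glued_local s x0.
by have := bC j x; rewrite sk subnn expr0 mulr1.
Qed.

Lemma laplacian_glued_local s (x : 'rV[R]_n) : x != 0 ->
  exists j, \forall y \near x,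
    pderivs s (laplacian u) y = pderivs s (laplacian (pc j)) y.
Proof.
move=> /(glued_local k i0 i1)[j uj]; exists j; apply: near_pderivs.
move/near_join: uj; apply: filterS => y uj; apply: eq_bigr => i _.
exact: nbhs_singleton (near_pderivs [:: i; i] uj).
Qed.

Lemma pderivs_laplacian_glued0 s : (size s <= k)%N ->
  pderivs s (laplacian u) 0 = 0.
Proof.
move=> sk; rewrite (pderivs_laplacian glued_smooth)// fct_sumE big1// => i _.
by apply: pderivs_glued0; rewrite size_cat addn2.
Qed.

Lemma pderivs_laplacian_piece_out j s x : (size s <= k)%N ->
  radius R j < `|x - center R i0 j| -> pderivs s (laplacian (pc j)) x = 0.
Proof.
move=> sk xj; have sk2 : (size s <= k.+2)%N by lia.
rewrite (pderivs_laplacian (piece_smooth i0 i1 j) sk2) fct_sumE big1// => i _.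
exact: pderivs_piece_out.
Qed.

(** Away from the origin the glued function is one of the pieces, which are
    smooth enough; at the origin the derivatives of the Laplacian are [O(|x|)],
    since [dyad R j] is at most [2 * `|x|] on the ball of [piece j]. *)
Lemma laplacian_glued_Ck : i0 != i1 -> Ck k (laplacian u).
Proof.
move=> i01; split=> [s i x sk|s sk x].
  apply: diff_derivable; rewrite (pderivs_laplacian glued_smooth) ?(ltnW sk)//.
  apply: differentiable_sum => l; apply: glued_smooth.
  by rewrite size_cat addn2 !ltnS.
have [->|x0] := eqVneq x 0.
  have [C [C0 bC]] := pderivs_laplacian_piece_le R i01 sk.
  apply: (@continuous_lipschitz0 _ _ _ _ (C * 2)).
    exact: pderivs_laplacian_glued0.
  move=> y; have [->|y0] := eqVneq y 0.
    by rewrite pderivs_laplacian_glued0// !normr0 mulr0.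
  have [j /nbhs_singleton ->] := laplacian_glued_local s y0.
  have [yj|yj] := ltP (radius R j) `|y - center R i0 j|.
    rewrite pderivs_laplacian_piece_out// normr0.
    by rewrite !mulr_ge0.
  have [dy _] := support_near0 yj; apply: (le_trans (bC j y)).
  by rewrite -mulrA ler_wpM2l.
have [j uj] := laplacian_glued_local s x0.
have uj' : \forall y \near x,
    pderivs s (laplacian (pc j)) y = pderivs s (laplacian u) y.
  by apply: filterS uj => y /esym.
have sk2 : (size s <= k.+2)%N by lia.
have dp : differentiable (pderivs s (laplacian (pc j))) x.
  rewrite (pderivs_laplacian (piece_smooth i0 i1 j) sk2).
  apply: differentiable_sum => i; apply: piece_smooth.
  by rewrite size_cat addn2; lia.
have du : differentiable (pderivs s (laplacian u)) x := near_differentiable uj' dp.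
exact: differentiable_continuous.
Qed.

Lemma glued_compactly_supported : compactly_supported u.
Proof.
have B : closure [set x | u x != 0] `<=` [set x | `|x| <= 2].
  have cB : closed [set x : 'rV[R]_n | `|x| <= 2].
    apply: (@closed_comp _ _ (fun x : 'rV[R]_n => `|x|) [set r | r <= 2]).
      by move=> x _; exact: norm_continuous.
    exact: closed_le.
  rewrite [X in _ `<=` X](closure_id _).1//; apply: closure_subset => x /=.
  apply: contra_neqT; rewrite -ltNge => x2; apply: glued_out => j.
  have := ler_distD (center R i0 j) x 0; rewrite !subr0 normr_center.
  by have := radius_le R j; have := dyad_le1 R j; have := radius_gt0 R j; lra.
apply: bounded_closed_compact; last exact: closed_closure.
exists 2; split; first exact: num_real.
by move=> M M2 x /B /= x2; apply: le_trans (ltW M2).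
Qed.

Lemma pderivs_glued_center j :
  pderivs (nseq k.+2 i0) u (center R i0 j) =
  pderivs (nseq k.+2 i0) (profile k i0 i1 j) 0.
Proof.
have cj : `|center R i0 j - center R i0 j| < 2 * radius R j.
  by rewrite subrr normr0 mulr_gt0 ?radius_gt0.
have /(@near_pderivs _ _ _ _ _ (nseq k.+2 i0))/nbhs_singleton -> :=
  glued_near_center k i1 cj.
exact: pderivs_piece_center.
Qed.

(** Continuity at the origin would force the derivative of order [k.+2] to be
    small at the centres, where it is close to [(k.+2)`!]. *)
Lemma glued_not_Ck : i0 != i1 -> ~ Ck k.+2 u.
Proof.
move=> i01 [_ /(_ (nseq k.+2 i0))]; rewrite size_nseq => /(_ (leqnn _) 0) uc.
have [C bC] := pderivs_profile0 R k i01.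
have e0 : (0 : R) < 1 / 2 by [].
have /nbhs_normP[d /= d0 ud] : \forall x \near (0 : 'rV[R]_n),
    `|pderivs (nseq k.+2 i0) u x| < 1 / 2.
  have /cvgrPdist_lt/(_ _ e0) := uc; rewrite pderivs_glued0 ?size_nseq//.
  by apply: filterS => x; rewrite sub0r normrN.
have C1 : 0 < `|C| + 1 by rewrite ltr_wpDl.
have [j] : exists j, dyad R j < Num.min d (1 / 2 / (`|C| + 1)).
  by apply: dyad_small; rewrite lt_min d0 divr_gt0.
rewrite lt_min ltr_pdivlMr// => /andP[jd jC].
have jd' : `|0 - center R i0 j| < d by rewrite sub0r normrN normr_center.
have : `|pderivs (nseq k.+2 i0) u (center R i0 j)| < 1 / 2 := ud _ jd'.
rewrite pderivs_glued_center.
have := bC j; set p := pderivs _ _ _ => pC p2.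
have f1 : 1 <= (k.+2)`!%:R :> R by rewrite ler1n fact_gt0.
have : C * dyad R j <= (`|C| + 1) * dyad R j.
  rewrite ler_wpM2r ?(ltW (dyad_gt0 _ _))//.
  by apply: le_trans (ler_norm C) _; rewrite lerDl.
move: jC pC p2; rewrite mulrC ltr_norml ler_norml => jC /andP[p1 _] /andP[_ p2].
lra.
Qed.

End GluedRegularity.

Unset Implicit Arguments.

Theorem theorem1p3 (R : realType) (n k : nat) (hn : (2 <= n)%N)
    (phi : R -> R) (phi_Ck : Ck_pos k.+2 phi)
    (phi_lim : phi s @[s --> +oo%R] --> +oo%R)
    (dphi_lim : forall j : nat, (1 <= j <= k.+2)%N ->
       derive1n j phi s @[s --> +oo%R] --> (0 : R)) :
  exists u : 'rV[R]_n -> R,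
    [/\ compactly_supported u,
        times_differentiable k.+2 u,
        Ck k (laplacian u),
        (forall s : seq 'I_n, size s = k.+2 -> bounded_fun (pderivs s u)) &
        ~ Ck k.+2 u].
Proof.
pose i0 : 'I_n := Ordinal (ltnW hn); pose i1 : 'I_n := Ordinal hn.
have i01 : i0 != i1 by [].
exists (glued k i0 i1); split.
- exact: glued_compactly_supported.
- exact: glued_smooth.
- exact: laplacian_glued_Ck.
- by move=> s; exact: bounded_pderivs_glued.
- exact: glued_not_Ck.
Qed.
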